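(* Let $1\le p<\infty$ and let $\mu$ be a Radon measure on $\mathbb{R}$ satisfying both (i) whenever $f,g$ are extended real-valued Borel functions on $\mathbb{R}$ with $f=g$ $\mu$-a.e., then $T_t(f)=T_t(g)$ $\mu$-a.e. for all $t\in\mathbb{R}$; and (ii) whenever $f$ is a Borel function on $\mathbb{R}$ with $\int_{\mathbb{R}}|f(x)|^p\,d\mu(x)<\infty$, then $\int_{\mathbb{R}}|T_t(f)(x)|^p\,d\mu(x)<\infty$ for all $t\in\mathbb{R}$. Then $\{T_t\}_{t\in\mathbb{R}}$ is a $C_0$-group acting on $L^p(\mu)$; that is, $$\lim_{t\to 0}\|T_t(f)-f\|_p=0\quad\text{for all } f\in L^p(\mu).$$
   Context: A Radon measure on $\mathbb{R}$ is a positive Borel measure $\mu$ on $\mathbb{R}$ with $\mu([-n,n])<\infty$ for all $n\in\mathbb{N}$. For an extended real-valued function $f$ on $\mathbb{R}$ and $t\in\mathbb{R}$, $T_t(f)(x)=f(x-t)$. Under (i) and (ii) the $T_t$ act on $L^p(\mu)$ as a group of linear operators on equivalence classes. $\|\cdot\|_p$ is the norm of $L^p(\mu)$. *)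

(* Defs.v *)
From HB Require Import structures.
From mathcomp Require Import all_boot all_order all_algebra.
From mathcomp Require Import all_classical all_reals all_analysis.

Set Implicit Arguments.
Unset Strict Implicit.
Unset Printing Implicit Defensive.

Import Order.TTheory GRing.Theory Num.Theory.
Import numFieldNormedType.Exports.

Local Open Scope classical_set_scope.
Local Open Scope ring_scope.

(* The sigma-algebra of [measurableTypeR R] is the Borel one. *)
Definition is_radon (R : realType)
    (mu : {measure set (measurableTypeR R) -> \bar R}) : Prop :=
  forall n : nat, (mu `[(- n%:R)%R, n%:R]%classic < +oo)%E.

(* The codomain is left free so that the same translation acts on extended
   real-valued functions (Y := \bar R) and on real-valued ones (Y := R). *)
Definition translate (R : realType) (Y : Type) (t : R) (f : R -> Y) : R -> Y :=
  fun x => f (x - t).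

(* [S] induces a C_0-group of bounded linear operators on the space L^p(mu) of
   mu-a.e. classes.  The library puts no vector space structure on its quotient
   [LspaceType], so an operator on L^p(mu) is given here by its action on the
   p-integrable functions [Lfun mu p]; all identities between elements of
   L^p(mu) are a.e. equalities, and the first two fields say that [S t] is a
   well-defined map from L^p(mu) to itself. *)
Record is_C0_group (d : measure_display) (T : measurableType d) (R : realType)
    (mu : {measure set T -> \bar R}) (p : \bar R)
    (S : R -> (T -> R) -> (T -> R)) : Prop := IsC0Group {
  C0_stable : forall t f, f \in Lfun mu p -> S t f \in Lfun mu p ;
  C0_class : forall t f g, f \in Lfun mu p -> g \in Lfun mu p ->
    f = g %[ae mu] -> S t f = S t g %[ae mu] ;
  C0_linear : forall t (a : R) f g, f \in Lfun mu p -> g \in Lfun mu p ->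
    S t (fun x => a * f x + g x) = (fun x => a * S t f x + S t g x) %[ae mu] ;
  C0_bounded : forall t, exists C : R, forall f, f \in Lfun mu p ->
    ('N[mu]_p[EFin \o S t f] <= C%:E * 'N[mu]_p[EFin \o f])%E ;
  C0_id : forall f, f \in Lfun mu p -> S 0 f = f %[ae mu] ;
  C0_comp : forall s t f, f \in Lfun mu p ->
    S (s + t) f = S s (S t f) %[ae mu] ;
  C0_continuous : forall f, f \in Lfun mu p ->
    ('N[mu]_p[EFin \o (fun x => S t f x - f x)%R])%E @[t --> (0 : R)^']
      --> 0%E
}.

(* Main.v *)
Require Import Defs.
From HB Require Import structures.
From mathcomp Require Import all_boot all_order all_algebra.
From mathcomp Require Import all_classical all_reals all_analysis.
From mathcomp Require Import measurable_realfun.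
From mathcomp Require Import ring.

Set Implicit Arguments.
Unset Strict Implicit.
Unset Printing Implicit Defensive.

Import Order.TTheory GRing.Theory Num.Theory.
Import numFieldNormedType.Exports.

Local Open Scope classical_set_scope.
Local Open Scope ring_scope.

(** Write A + t for the translate of a set A; as a set is a predicate, this is
[translate t A].

Everything follows from a bound mu (A + s) <= M * mu A that is uniform in the
Borel set A and in s near 0. It is obtained in two steps.

For a fixed t, a constant C_t exists by a gliding hump
([translate_measure_bounded]). If mu (A_n + t) > 4^n mu (A_n) for every n, then
the function sum_n 2^-(n+1) / mu (A_n) 1_(A_n) is integrable while its translate
is not, against (ii). Hypothesis (i) gives mu (A_n) > 0 and allows the values of
that function to be changed on a null set, so that its p-th root is real-valued.

The bound is made uniform by Baire's theorem
([translate_measure_locally_bounded]). For an open set U, the function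
t |-> mu (U + t) is lower semicontinuous, so the set of t such that
mu (U + t) <= n mu U for all open U is closed. These sets cover the line, so one
of them contains a ball, which the group law moves to 0. Borel sets of finite
measure are approximated by open sets in the sense of symmetric differences
([open_approx_radon]), and the cruder constant C_s absorbs the error.

The uniform bound gives mu (A `+` (A + s)) -> 0 for A of finite measure: for A
open because A erodes continuously ([open_translate_setY_small]), and then for
all A by approximation. By density of simple functions, translation is
continuous in L^1(mu) ([integrable_translation_L1_continuous]).

The passage to L^p(mu) uses the signed power phi a = sgn a |a|^p. If f is in
L^p(mu) then phi o f is in L^1(mu), and |a - b|^p <= 2^p |phi a - phi b|
([powR_le_signed_powR]) bounds the p-th power of the norm of T_s f - f by 2^p
times the L^1 norm of T_s (phi o f) - phi o f. *)

(** * Translates of Borel sets *)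

Lemma cvge0_exists_le (R : realType) (u : (\bar R)^nat) (e : R) :
  u @ \oo --> 0%E -> 0 < e -> exists n, (u n <= e%:E)%E.
Proof.
move=> u0 e0; apply: contrapT => /forallNP ue.
have : (e%:E <= 0)%E.
  apply: cvge_ge u0; apply: nearW => n.
  by move/negP: (ue n); rewrite -ltNge => /ltW.
by rewrite lee_fin leNgt e0.
Qed.

Section translation_measurable.
Context (R : realType).
Implicit Types (t : R) (A : set (measurableTypeR R)).

Lemma measurable_subr t :
  measurable_fun setT
    ((fun x => x - t) : measurableTypeR R -> measurableTypeR R).
Proof. by apply: measurable_funB. Qed.

Lemma measurable_translate t d (Y : measurableType d)
    (f : measurableTypeR R -> Y) :
  measurable_fun setT f ->
  measurable_fun setT (translate t f : measurableTypeR R -> Y).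
Proof. by move=> mf; exact: (measurableT_comp mf (measurable_subr t)). Qed.

Lemma measurable_translate_set t A :
  measurable A -> measurable (translate t A : set (measurableTypeR R)).
Proof.
by move=> mA; rewrite -[translate t A]setTI; exact: (measurable_subr t).
Qed.

(** The measure A |-> mu (A + t), as an instance of the measure structure. *)
Definition shift_measure (mu : {measure set (measurableTypeR R) -> \bar R}) t
  : set (measurableTypeR R) -> \bar R :=
  pushforward mu ((fun x => x - t) : measurableTypeR R -> measurableTypeR R).

HB.instance Definition _ (mu : {measure set (measurableTypeR R) -> \bar R}) t :=
  Measure.copy (shift_measure mu t)
    (measure_function_pushforward__canonical__measure_function_Measure mu
       (measurable_subr t)).

Lemma translate_null (mu : {measure set (measurableTypeR R) -> \bar R}) t A :
  (forall f g : measurableTypeR R -> \bar R, measurable_fun setT f ->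
    measurable_fun setT g -> f = g %[ae mu] ->
    forall t : R, translate t f = translate t g %[ae mu]) ->
  measurable A -> mu A = 0%E -> mu (translate t A) = 0%E.
Proof.
move=> mu_i mA A0.
have mtA := measurable_translate_set t mA.
have mI : measurable_fun setT (EFin \o \1_A : measurableTypeR R -> \bar R).
  by apply/measurable_EFinP; exact: measurable_indic.
have A0ae : (EFin \o \1_A : measurableTypeR R -> \bar R) = cst 0%E %[ae mu].
  exists A; split => // x /= /not_implyP[_]; apply: contra_notP => Ax.
  by rewrite indicE memNset.
have [N [mN N0 tAN]] := mu_i _ _ mI (measurable_cst _) A0ae t.
apply/eqP; rewrite eq_le measure_ge0 andbT -N0 le_measure ?inE//.
move=> x Ax; apply: tAN => /= /(_ Logic.I) [].
rewrite /translate /= indicE mem_set//; exact/eqP/oner_neq0.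
Qed.

End translation_measurable.

(** * Erosion of open sets *)

Section erosion.
Context (R : realType).
Implicit Types (U : set R) (e t : R).

(** Erosions exhaust an open set and remain inside it under small translations;
this is how the topology of the line enters the measure estimates. *)
Definition erosion U e : set R := [set x | ball x e `<=` U].

Lemma erosion_closed U e : 0 < e -> closed (erosion U e).
Proof.
move=> e0; rewrite -openC openE => x /= /existsNP[y /not_implyP[xy Uy]].
have := @ball_open R R y e; rewrite openE => /(_ _ (ball_sym xy)) ye.
apply: (filterS _ ye) => z yz /= /(_ y (ball_sym yz)).
exact: Uy.
Qed.

Lemma erosion_sub U e : 0 < e -> erosion U e `<=` U.
Proof. by move=> e0 x; apply; exact: ballxx. Qed.

Lemma le_erosion U e f : e <= f -> erosion U f `<=` erosion U e.
Proof. by move=> ef x xf; apply: subset_trans xf; exact: le_ball. Qed.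

Lemma measurable_erosion U e : 0 < e ->
  measurable (erosion U e : set (measurableTypeR R)).
Proof. by move=> e0; apply: closed_measurable; exact: erosion_closed. Qed.

Lemma erosion_translate U e s t : `|s - t| < e ->
  translate t (erosion U e) `<=` translate s U.
Proof.
move=> ste x; apply; rewrite /ball/= opprB addrC addrA subrK.
by rewrite -(opprK t) opprK.
Qed.

Lemma bigcup_erosion U : open U -> \bigcup_n erosion U n.+1%:R^-1 = U.
Proof.
move=> oU; apply/seteqP; split => [x [n _]|x Ux]; first exact: erosion_sub.
have /nbhs_ballP[e/= e0 xeU] : nbhs x U by exact: open_nbhs_nbhs.
have [n ne] : exists n, n.+1%:R^-1 < e.
  exists (Num.trunc e^-1); rewrite invf_plt ?posrE//.
  by rewrite truncnS_gt.
by exists n => //; apply: subset_trans xeU; apply: le_ball; exact: ltW.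
Qed.

Lemma nondecreasing_erosion U :
  {homo (fun n => erosion U n.+1%:R^-1) : m n / (m <= n)%N >-> (m <= n)%O}.
Proof.
move=> m n mn; apply/subsetPset; apply: le_erosion.
by rewrite lef_pV2 ?posrE// ler_nat ltnS.
Qed.

Lemma erosion_approx (m : {measure set (measurableTypeR R) -> \bar R}) U e :
  open U -> (m U < +oo)%E -> 0 < e ->
  exists2 d, 0 < d & (m (U `\` erosion U d) <= e%:E)%E.
Proof.
move=> oU Uoo e0; have mU : measurable (U : set (measurableTypeR R)).
  exact: open_measurable.
pose F n : set (measurableTypeR R) := U `\` erosion U n.+1%:R^-1.
have mF n : measurable (F n).
  by apply: measurableD => //; exact: measurable_erosion.
have F0 : \bigcap_n F n = set0.
  rewrite -subset0 => x Fx; have := (Fx 0%N Logic.I).1.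
  by rewrite -{1}(bigcup_erosion oU) => -[n _ xn]; exact: (Fx n Logic.I).2.
have : (m \o F) @ \oo --> m (\bigcap_n F n).
  apply: nonincreasing_cvg_mu => //.
  - by apply: le_lt_trans Uoo; rewrite le_measure ?inE//; exact: subDsetl.
  - exact: bigcap_measurable.
  - move=> i j ij; apply/subsetPset; apply: setDS; apply/subsetPset.
    exact: nondecreasing_erosion.
rewrite F0 measure0 => Fcvg.
have [n Fn] := cvge0_exists_le Fcvg e0.
by exists n.+1%:R^-1; rewrite // invr_gt0.
Qed.

End erosion.
(** * Approximation of Borel sets by open sets *)

Lemma measure_le_add d (T : measurableType d) (R : realType)
    (m : {measure set T -> \bar R}) (A B C : set T) :
  measurable A -> measurable B -> measurable C -> A `<=` B `|` C ->
  (m A <= m B + m C)%E.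
Proof.
move=> mA mB mC ABC; apply: le_trans (measureU2 _ mB mC).
by rewrite le_measure ?inE//; exact: measurableU.
Qed.

Lemma measurable_setY d (T : measurableType d) (A B : set T) :
  measurable A -> measurable B -> measurable (A `+` B).
Proof.
by move=> mA mB; rewrite setY_def; apply: measurableU; exact: measurableD.
Qed.

Lemma setY_triangle T (A B C : set T) : A `+` C `<=` (A `+` B) `|` (B `+` C).
Proof.
rewrite !setY_def => x; have [Bx|Bx] := pselect (B x).
  by move=> [[Ax Cx]|[Cx Ax]]; [right; left|left; right].
by move=> [[Ax Cx]|[Cx Ax]]; [left; left|right; right].
Qed.

Lemma setYCC T (A B : set T) : ~` A `+` ~` B = A `+` B.
Proof.
by rewrite !setY_def setUC; congr (_ `|` _); rewrite setDE setCK setIC -setDE.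
Qed.

Section open_approximation.
Context (R : realType).
Implicit Types (A U : set (measurableTypeR R)) (e : R).

(** The sets that can be approximated in the sense of symmetric differences form a
sigma-algebra: a complement is handled by replacing the open set U by a closed
erosion of U, whose complement is open. *)
Lemma open_approx (m : {measure set (measurableTypeR R) -> \bar R}) A e :
  (m setT < +oo)%E -> measurable A -> 0 < e ->
  exists2 U : set R, open U & (m (A `+` U) <= e%:E)%E.
Proof.
move=> moo mA; move: e.
pose G := [set A : set (measurableTypeR R) | measurable A /\ forall e, 0 < e ->
  exists2 U : set R, open U & (m (A `+` U) <= e%:E)%E].
suff : G A by move=> [].
have oM (U : set R) : open U -> measurable (U : set (measurableTypeR R)).
  by move=> oU; exact: open_measurable.
have GO (U : set R) : open U -> G U.
  move=> oU; split; first exact: oM.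
  by move=> e e0; exists U => //; rewrite setYK measure0 lee_fin ltW.
suff GS : sigma_algebra setT G.
  have : (@RGenOpens.G R).-sigma.-measurable A by rewrite -RGenOpens.measurableE.
  move: A mA => A _; move: A.
  by apply: smallest_sub => // _ [x [y ->]]; apply: GO; exact: interval_open.
split.
- by apply: GO; exact: open0.
- move=> {mA}A [mA GA]; rewrite setTD; split; first exact: measurableC.
  move=> e e0; have e20 : 0 < e / 2 by rewrite divr_gt0.
  have [U oU AU] := GA _ e20.
  have Uoo : (m U < +oo)%E.
    by apply: le_lt_trans moo; rewrite le_measure ?inE//; exact: oM.
  have [d d0 Ud] := erosion_approx oU Uoo e20.
  have mE := measurable_erosion U d0.
  exists (~` erosion U d); first by rewrite openC; exact: erosion_closed.
  rewrite setYCC (splitr e) EFinD; apply: le_trans (leeD AU Ud).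
  apply: measure_le_add.
  + exact: measurable_setY.
  + by apply: measurable_setY => //; exact: oM.
  + by apply: measurableD => //; exact: oM.
  + apply: subset_trans (@setY_triangle _ _ U _) _.
    rewrite [U `+` _]setY_def (_ : erosion U d `\` U = set0) ?setU0//.
    by rewrite setD_eq0; exact: erosion_sub.
- move=> B GB; split; first by apply: bigcupT_measurable => k; case: (GB k).
  move=> e e0.
  have /choice[U UB] : forall n, exists U : set R,
      open U /\ (m (B n `+` U) <= (e / (2 ^ n.+1)%:R)%:E)%E.
    move=> n; have [|U oU BU] := (GB n).2 (e / (2 ^ n.+1)%:R).
      by rewrite divr_gt0// ltr0n expn_gt0.
    by exists U.
  have mBU k : measurable (B k `+` U k).
    by apply: measurable_setY; [case: (GB k)|apply: oM; exact: (UB k).1].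
  exists (\bigcup_n U n).
    by apply: bigcup_open => i _; exact: (UB i).1.
  apply: (@le_trans _ _ (\sum_(k <oo) m (B k `+` U k))%E).
    apply: measure_sigma_subadditive => //.
      apply: measurable_setY.
        by apply: bigcupT_measurable => k; case: (GB k).
      by apply: bigcupT_measurable => k; apply: oM; exact: (UB k).1.
    rewrite setY_def => x [[[n _ Bx] Ux]|[[n _ Ux] Bx]].
      by exists n => //; rewrite setY_def; left; split => // Unx; apply: Ux; exists n.
    by exists n => //; rewrite setY_def; right; split => // Bnx; apply: Bx; exists n.
  apply: le_trans (epsilon_trick0 xpredT (ltW e0)).
  by apply: lee_nneseries => // k _; exact: (UB k).2.
Qed.

(** A set of finite measure is, up to a small error, contained in a bounded open
interval D, and mu restricted to D is finite. *)
Lemma open_approx_radon (mu : {measure set (measurableTypeR R) -> \bar R}) A e :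
  is_radon mu -> measurable A -> (mu A < +oo)%E -> 0 < e ->
  exists2 U : set R, open U & (mu U < +oo)%E /\ (mu (A `+` U) <= e%:E)%E.
Proof.
move=> mur mA Aoo e0; have e20 : 0 < e / 2 by rewrite divr_gt0.
pose D n : set (measurableTypeR R) := `](- n%:R)%R, n%:R[%classic.
have oD n : open (D n : set R) by exact: interval_open.
have mD n : measurable (D n) by exact: open_measurable.
have Doo n : (mu (D n) < +oo)%E.
  apply: le_lt_trans (mur n); rewrite le_measure ?inE//.
  exact: subset_itv_oo_cc.
have Dnd i j : (i <= j)%N -> D i `<=` D j.
  by move=> ij; apply: subset_itvW; rewrite ?lerN2 ler_nat.
have : (mu \o (fun n => A `\` D n)) @ \oo --> mu (\bigcap_n (A `\` D n)).
  apply: nonincreasing_cvg_mu => //.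
  - apply: le_lt_trans Aoo; rewrite le_measure ?inE//; exact: measurableD.
  - by move=> n; exact: measurableD.
  - by apply: bigcap_measurable => // n _; exact: measurableD.
  - by move=> i j ij; apply/subsetPset; apply: setDS; exact: Dnd.
have -> : \bigcap_n (A `\` D n) = set0.
  rewrite -subset0 => x ADx; apply: (ADx (Num.trunc `|x|).+1 Logic.I).2.
  by rewrite /D/= in_itv/= -ltr_norml truncnS_gt.
rewrite measure0 => /cvge0_exists_le-/(_ _ e20)[n ADn].
have [|U oU AU] := @open_approx (mrestr mu (mD n)) _ _ _ mA e20.
  by rewrite /= /mrestr setTI; exact: Doo.
have mU : measurable (U : set (measurableTypeR R)) by exact: open_measurable.
exists (U `&` D n); first exact: openI.
split.
  apply: le_lt_trans (Doo n); rewrite le_measure ?inE//; exact: measurableI.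
rewrite (splitr e) EFinD; apply: le_trans (leeD ADn AU).
rewrite /= /mrestr; apply: measure_le_add.
- by apply: measurable_setY => //; exact: measurableI.
- exact: measurableD.
- by apply: measurableI => //; exact: measurable_setY.
- rewrite !setY_def => x [[Ax UDx]|[[Ux Dx] Ax]].
    have [Dx|Dx] := pselect (D n x); last by left.
    by right; split => //; left; split => // Ux; apply: UDx.
  by right; split => //; right.
Qed.

End open_approximation.
(** * Boundedness of each translation *)

Section gliding_hump.
Context (R : realType) (p : R) (mu : {measure set (measurableTypeR R) -> \bar R}).
Hypothesis p1 : 1 <= p.
Hypothesis mu_i : forall f g : measurableTypeR R -> \bar R,
  measurable_fun setT f -> measurable_fun setT g -> f = g %[ae mu] ->
  forall t : R, translate t f = translate t g %[ae mu].
Hypothesis mu_ii : forall f : measurableTypeR R -> R, measurable_fun setT f ->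
  (\int[mu]_x (`|f x| `^ p)%:E < +oo)%E ->
  forall t : R, (\int[mu]_x (`|translate t f x| `^ p)%:E < +oo)%E.
Implicit Types (t : R) (h : measurableTypeR R -> \bar R).

(** Hypothesis (ii) is applied to the p-th root of the real-valued function
[fine \o h]; (i) is what lets a translate of h be replaced by the translate of
this almost everywhere equal version. *)
Lemma translate_integral_lty t h : measurable_fun setT h ->
  (forall x, 0 <= h x)%E -> (\int[mu]_x h x < +oo)%E ->
  (\int[mu]_x translate t h x < +oo)%E.
Proof.
move=> mh h0 hoo.
have p0 : p != 0 by rewrite gt_eqF// (lt_le_trans ltr01).
pose f x := fine (h x) `^ p^-1.
have fpE x : `|f x| `^ p = fine (h x).
  by rewrite ger0_norm ?powR_ge0// -powRrM mulVf// powRr1// fine_ge0.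
have mfh : measurable_fun setT (fine \o h) by exact: measurableT_comp.
have mf : measurable_fun setT f.
  exact: (@measurableT_comp _ _ _ _ _ _ (@powR R ^~ p^-1)).
have fh_ae : (EFin \o (fine \o h) : measurableTypeR R -> \bar R) = h %[ae mu].
  have := @integrable_ae _ _ _ mu _ measurableT h.
  move=> /(_ _)/(filterS _); apply.
    move=> x /(_ Logic.I) hx _ /=; exact: fineK.
  apply/integrableP; split => //.
  by under eq_integral do rewrite gee0_abs//.
have mEf : measurable_fun setT (EFin \o (fine \o h)) by exact/measurable_EFinP.
rewrite -(@ge0_ae_eq_integral _ _ _ mu _ (translate t (EFin \o (fine \o h)))) //.
- have -> : (\int[mu]_x translate t (EFin \o (fine \o h)) x =
      \int[mu]_x (`|translate t f x| `^ p)%:E)%E.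
    by apply: eq_integral => x _; rewrite /translate fpE.
  apply: mu_ii => //; under eq_integral do rewrite fpE.
  apply: le_lt_trans hoo.
  apply: ge0_le_integral => // x _; first by rewrite lee_fin fine_ge0.
  by move: (h0 x); case: (h x).
- exact: measurable_translate.
- exact: measurable_translate.
- by move=> x _; rewrite /translate/= lee_fin fine_ge0.
- by move=> x _; exact: h0.
- exact: mu_i.
Qed.

(** Gliding hump: violations of the bound by factors 4^n are summed with weights
2^-(n+1) / mu (A n), which keep the sum h integrable while the integral of its
translate is at least 4^n 2^-(n+1) for every n. *)
Lemma translate_measure_bounded t : exists2 C : R, 0 < C &
  forall A : set (measurableTypeR R), measurable A ->
    (mu (translate t A) <= C%:E * mu A)%E.
Proof.
apply: contrapT => H.
have /choice[A HA] : forall n, exists A : set (measurableTypeR R),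
    measurable A /\ ((4 ^+ n)%:E * mu A < mu (translate t A))%E.
  move=> n; apply: contrapT => /forallNP HA; apply: H.
  exists (4 ^+ n) => [|A mA]; first by rewrite exprn_gt0.
  by rewrite leNgt; apply/negP => ?; apply: (HA A).
have mA n : measurable (A n) := (HA n).1.
have mtA n : measurable (translate t (A n) : set (measurableTypeR R)).
  exact: measurable_translate_set.
have A0 n : (0 < mu (A n))%E.
  rewrite lt0e measure_ge0 andbT; apply/eqP => A0.
  by have := (HA n).2; rewrite A0 mule0 translate_null// ltxx.
have Aoo n : (mu (A n) < +oo)%E.
  rewrite ltey; apply/eqP => Aoo; have := (HA n).2.
  by rewrite Aoo gt0_muley ?lte_fin ?exprn_gt0// ltNge leey.
have Afin n : mu (A n) \is a fin_num by rewrite ge0_fin_numE.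
pose a n := fine (mu (A n)).
have aE n : mu (A n) = (a n)%:E by rewrite fineK.
have a0 n : 0 < a n by rewrite -lte_fin -aE.
pose c n := 1 / (2 ^ n.+1)%:R / a n.
have c0 n : 0 <= c n by rewrite !divr_ge0// ltW.
pose h x := (\sum_(n <oo) ((c n)%:E * (\1_(A n) x)%:E))%E.
have m1 (B : set (measurableTypeR R)) : measurable B ->
    measurable_fun setT (fun x : measurableTypeR R => (\1_B x : R)%:E).
  by move=> mB; apply/measurable_EFinP; exact: measurable_indic.
have mI n : measurable_fun setT (fun x => (c n)%:E * (\1_(A n) x)%:E)%E.
  by apply: emeasurable_funM => //; exact: m1.
have I0 n x : (0 <= (c n)%:E * (\1_(A n) x)%:E)%E.
  by rewrite mule_ge0// lee_fin.
have mh : measurable_fun setT (h : measurableTypeR R -> _).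
  by apply: ge0_emeasurable_sum.
have h0 x : (0 <= h x)%E by apply: nneseries_ge0.
have hoo : (\int[mu]_x h x < +oo)%E.
  rewrite integral_nneseries//.
  apply: (@le_lt_trans _ _ 1%:E); last by rewrite ltry.
  apply: le_trans (epsilon_trick0 xpredT (@ler01 R)).
  apply: lee_nneseries => [n _ _|n _]; first exact: integral_ge0.
  rewrite ge0_integralZl//; [|exact: m1|by rewrite lee_fin].
  rewrite integral_indic// setIT aE -EFinM lee_fin.
  by rewrite /c divfK// gt_eqF.
have thoo := translate_integral_lty t mh h0 hoo.
have tI n : (((2 ^+ n) / 2)%:E <= \int[mu]_x translate t h x)%E.
  apply: (@le_trans _ _
      (\int[mu]_x ((c n)%:E * (\1_(translate t (A n)) x)%:E))%E).
    rewrite ge0_integralZl//; [|exact: m1|by rewrite lee_fin].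
    rewrite integral_indic// setIT.
    apply: (@le_trans _ _ ((c n)%:E * ((4 ^+ n)%:E * mu (A n)))%E); last first.
      by apply: lee_wpmul2l; rewrite ?lee_fin// ltW// (HA n).2.
    have E4 : (4 : R) ^+ n = 2 ^+ n * 2 ^+ n.
      by rewrite -exprMn; congr (_ ^+ n); ring.
    rewrite aE -!EFinM lee_fin E4 /c natrX exprS.
    rewrite [leRHS](_ : _ = 2 ^+ n / 2)//; field.
    by rewrite gt_eqF//= expf_neq0.
  apply: ge0_le_integral => //.
  - by move=> x _; rewrite mule_ge0// lee_fin.
  - by apply: emeasurable_funM => //; exact: m1.
  - exact: measurable_translate.
  - move=> x _; rewrite /translate /h (@nneseriesD1 _ _ n)//.
    by rewrite leeDl// nneseries_ge0.
have toofin : (\int[mu]_x translate t h x)%E \is a fin_num.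
  by rewrite ge0_fin_numE//; apply: integral_ge0 => x _; exact: h0.
pose B := fine (\int[mu]_x translate t h x)%E.
have := tI (Num.trunc (B * 2)).+1; rewrite -(fineK toofin) -/B lee_fin leNgt.
move=> /negP; apply; rewrite ltr_pdivlMr//.
apply: lt_le_trans (truncnS_gt _) _.
by rewrite -natrX ler_nat ltnW// ltn_expl.
Qed.

End gliding_hump.
(** * A uniform bound near 0 *)

Section local_bound.
Context (R : realType) (mu : {measure set (measurableTypeR R) -> \bar R}).
Hypothesis mu_radon : is_radon mu.
Hypothesis mu_bounded : forall t : R, exists2 C : R, 0 < C &
  forall A : set (measurableTypeR R), measurable A ->
    (mu (translate t A) <= C%:E * mu A)%E.
Implicit Types (t s : R) (U : set R) (A : set (measurableTypeR R)).

(** Lower semicontinuity of t |-> mu (U + t): a strict lower bound on mu (U + t)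
already holds for an erosion E of U, and U + s contains E + t for s near t. *)
Lemma open_unbounded_translations (n : R) :
  0 <= n ->
  open [set t | exists2 U, open U & (n%:E * mu U < mu (translate t U))%E].
Proof.
move=> n0; rewrite openE => t [U oU nU].
have mtE k : measurable
    (translate t (erosion U k.+1%:R^-1) : set (measurableTypeR R)).
  by apply: measurable_translate_set; exact: measurable_erosion.
have tU : \bigcup_k translate t (erosion U k.+1%:R^-1) = translate t U.
  by rewrite -[in RHS](bigcup_erosion oU).
have tUcvg : mu (translate t (erosion U k.+1%:R^-1)) @[k --> \oo] -->
    mu (translate t U).
  rewrite -tU; apply: nondecreasing_cvg_mu => //.
  - exact: bigcupT_measurable.
  - move=> i j ij; apply/subsetPset => x.
    by have /subsetPset := nondecreasing_erosion U ij; apply.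
have [k nk] : exists k,
    (n%:E * mu U < mu (translate t (erosion U k.+1%:R^-1)))%E.
  apply: contrapT => /forallNP H; move: nU; rewrite ltNge => /negP; apply.
  apply: cvge_le tUcvg; apply: nearW => k; rewrite leNgt; exact/negP.
exists k.+1%:R^-1 => //= s ts; exists U => //.
apply: (lt_le_trans nk); rewrite le_measure ?inE//.
  by apply: measurable_translate_set; exact: open_measurable.
apply: erosion_translate.
by move: ts; rewrite /= distrC.
Qed.

(** Baire's theorem for the open sets of the previous lemma, for n ranging over
the natural numbers: their intersection is empty because each translation is bounded,
so one of them is not dense. *)
Lemma ball_bounded_translations : exists n a r, [/\ 0 < r, 0 <= n &
  forall t U, ball a r t -> open U ->
    (mu (translate t U) <= n%:E * mu U)%E].
Proof.
apply: contrapT => H.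
pose F (n : nat) : set R :=
  [set t | exists2 U, open U & (n%:R%:E * mu U < mu (translate t U))%E].
have FD i : open (F i) /\ dense (F i).
  split; first exact: open_unbounded_translations.
  apply: contrapT => /denseNE [V [[a [oV Va]] VF]].
  have /nbhs_ballP[r/= r0 aV] : nbhs a V by exact: open_nbhs_nbhs.
  apply: H; exists i%:R, a, r; split => // t U rt oU.
  rewrite leNgt; apply/negP => nU.
  suff : (V `&` F i) t by rewrite VF.
  by split; [exact: aV|exists U].
have [//|t [_ Ft]] := @Baire R R F FD setT _ openT; first by exists 0.
have [C C0 CA] := mu_bounded t.
have [U oU] := Ft (Num.trunc C).+1 Logic.I.
rewrite ltNge => /negP; apply.
apply: le_trans (CA U _) _; first exact: open_measurable.
by apply: lee_wpmul2r => //; rewrite lee_fin ltW// truncnS_gt.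
Qed.

(** The ball centred at a is moved to 0 at the cost of the norm of the translation
by - a. For a general A, take U open with mu (A `+` U) small: A + s lies in
(U + s) `|` ((A `+` U) + s), and the second set is small by the bound for s
alone. *)
Lemma translate_measure_locally_bounded : exists2 M : R, 0 < M &
  exists2 r, 0 < r & forall s A, `|s| < r -> measurable A ->
    (mu (translate s A) <= M%:E * mu A)%E.
Proof.
have [n [a [r [r0 n0 naU]]]] := ball_bounded_translations.
have [C C0 CA] := mu_bounded (- a).
pose M := C * (n + 1).
have M0 : 0 < M by rewrite mulr_gt0// ltr_wpDl.
exists M => //; exists r => // s A sr mA.
have MU (U : set R) : open U -> (mu (translate s U) <= M%:E * mu U)%E.
  move=> oU.
  have -> : translate s U = translate (- a) (translate (a + s) U).
    by apply/funext => x; rewrite /translate; congr U; ring.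
  apply: (le_trans (CA (translate (a + s) U) _)).
    by apply: measurable_translate_set; exact: open_measurable.
  rewrite /M EFinM -muleA; apply: lee_wpmul2l; first by rewrite lee_fin ltW.
  apply: le_trans (naU _ _ _ oU) _.
    by rewrite /ball/= opprD addNKr normrN.
  by rewrite lee_wpmul2r// lee_fin lerDl.
have [->|Aoo] := eqVneq (mu A) +oo%E.
  by rewrite gt0_muley ?leey// lte_fin.
have [K K0 KA] := mu_bounded s.
(* This error makes both terms below, M and K times it, add up to e. *)
apply/lee_addgt0Pr => e e0.
have d0 : 0 < e / (M + K) by rewrite divr_gt0// addr_gt0.
have [|U oU [Uoo AU]] := open_approx_radon mu_radon mA _ d0.
  by rewrite ltey.
have mU : measurable (U : set (measurableTypeR R)) by exact: open_measurable.
have mAU : measurable (A `+` U) by exact: measurable_setY.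
have UA : (mu U <= mu A + (e / (M + K))%:E)%E.
  apply: le_trans (leeD (lexx _) AU); apply: measure_le_add => //.
  move=> x Ux; have [Ax|Ax] := pselect (A x); first by left.
  by right; rewrite setY_def; right.
apply: (@le_trans _ _ (mu (translate s U) + mu (translate s (A `+` U)))%E).
  apply: measure_le_add; rewrite ?[measurable _]measurable_translate_set//.
  - exact: measurable_translate_set.
  - exact: measurable_translate_set.
  - exact: measurable_translate_set.
  - move=> x sA; have [Ux|Ux] := pselect (translate s U x); first by left.
    by right; rewrite setY_def; left.
apply: le_trans (leeD (MU _ oU) (KA _ mAU)) _.
apply: (@le_trans _ _ (M%:E * (mu A + (e / (M + K))%:E) +
                       K%:E * (e / (M + K))%:E)%E).
  by apply: leeD; apply: lee_wpmul2l; rewrite ?lee_fin ?(ltW M0) ?(ltW K0).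
rewrite ge0_muleDr ?lee_fin ?(ltW d0)// -addeA.
apply: leeD => //; rewrite -!EFinM -EFinD lee_fin.
by rewrite -mulrDl mulrCA divff ?mulr1// gt_eqF// addr_gt0.
Qed.

End local_bound.
(** * Continuity of translation in L1 *)

Section translation_L1.
Import HBSimple.
Context (R : realType) (mu : {measure set (measurableTypeR R) -> \bar R}).
Implicit Types (t s : R) (A : set (measurableTypeR R)).

Lemma integral_translate_le t (C : R) : 0 <= C ->
  (forall A, measurable A -> (mu (translate t A) <= C%:E * mu A)%E) ->
  forall h : measurableTypeR R -> \bar R,
  measurable_fun setT h -> (forall x, 0 <= h x)%E ->
  (\int[mu]_x translate t h x <= C%:E * \int[mu]_x h x)%E.
Proof.
move=> C0 CA h mh h0.
have -> : (\int[mu]_x translate t h x = \int[shift_measure mu t]_x h x)%E.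
  have := @ge0_integral_pushforward _ _ _ _ R _ (measurable_subr t) mu setT h
    measurableT mh.
  by rewrite preimage_setT => ->// x _; exact: h0.
rewrite -(@ge0_integral_mscale _ _ _ mu _ measurableT (NngNum C0))//.
by apply: ge0_le_measure_integral => // A mA; exact: CA.
Qed.

Hypothesis mu_radon : is_radon mu.
Context (M r : R).
Hypothesis M0 : 0 < M.
Hypothesis r0 : 0 < r.
Hypothesis mu_bounded : forall s A, `|s| < r -> measurable A ->
  (mu (translate s A) <= M%:E * mu A)%E.

(** For |s| < d a point of U outside U + s is not in the erosion of U by d, and a
point of U + s outside U is the translate of a point of U outside that
erosion. *)
Lemma open_translate_setY_small (U : set R) e : open U -> (mu U < +oo)%E -> 0 < e ->
  exists2 d, 0 < d & forall s, `|s| < d -> (mu (U `+` translate s U) <= e%:E)%E.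
Proof.
move=> oU Uoo e0; have e10 : 0 < e / (1 + M) by rewrite divr_gt0// addr_gt0.
have [d d0 Ud] := erosion_approx oU Uoo e10.
exists (Num.min d r) => [|s]; first by rewrite lt_min d0.
rewrite lt_min => /andP[sd sr].
have mU : measurable (U : set (measurableTypeR R)) by exact: open_measurable.
have mE := measurable_erosion U d0.
have mD : measurable (U `\` erosion U d : set (measurableTypeR R)).
  exact: measurableD.
apply: (@le_trans _ _ (mu (U `\` erosion U d) +
                       mu (translate s (U `\` erosion U d)))%E).
  apply: measure_le_add => //.
  - by apply: measurable_setY => //; exact: measurable_translate_set.
  - exact: measurable_translate_set.
  - have dN x y : ball x d y -> ball y d x by exact: ball_sym.
    rewrite setY_def => x [[Ux sUx]|[sUx Ux]]; [left|right]; split => // xE.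
      by apply/sUx/xE; rewrite /ball/= subKr.
    by apply/Ux/xE; rewrite /ball/= addrAC subrr sub0r normrN.
apply: le_trans (leeD Ud _) _.
  apply: le_trans (mu_bounded sr mD) _.
  by apply: lee_wpmul2l Ud; rewrite lee_fin ltW.
rewrite -EFinM -EFinD lee_fin -[X in X + _]mul1r -mulrDl mulrCA divff ?mulr1//.
by rewrite gt_eqF// addr_gt0.
Qed.

Lemma translate_setY_small A e : measurable A -> (mu A < +oo)%E -> 0 < e ->
  exists2 d, 0 < d & forall s, `|s| < d -> (mu (A `+` translate s A) <= e%:E)%E.
Proof.
move=> mA Aoo e0; have e10 : 0 < e / (2 + M) by rewrite divr_gt0// addr_gt0.
have [U oU [Uoo AU]] := open_approx_radon mu_radon mA Aoo e10.
have [d d0 Ud] := open_translate_setY_small oU Uoo e10.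
exists (Num.min d r) => [|s]; first by rewrite lt_min d0.
rewrite lt_min => /andP[sd sr].
have mU : measurable (U : set (measurableTypeR R)) by exact: open_measurable.
have mtA : measurable (translate s A : set (measurableTypeR R)).
  exact: measurable_translate_set.
have mtU : measurable (translate s U : set (measurableTypeR R)).
  exact: measurable_translate_set.
have mAU : measurable (A `+` U) by exact: measurable_setY.
have mUtA : measurable (U `+` translate s A) by exact: measurable_setY.
have mUtU : measurable (U `+` translate s U : set (measurableTypeR R)).
  exact: measurable_setY.
apply: (@le_trans _ _ (mu (A `+` U) + (mu (U `+` translate s U) +
                       mu (translate s (A `+` U))))%E).
  apply: (@le_trans _ _ (mu (A `+` U) + mu (U `+` translate s A))%E).
    apply: measure_le_add => //; last exact: setY_triangle.
    exact: measurable_setY.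
  apply: leeD => //; apply: measure_le_add => //.
    exact: measurable_translate_set.
  rewrite (_ : translate s (A `+` U) = translate s U `+` translate s A).
    exact: setY_triangle.
  by rewrite (setYC A).
apply: le_trans (leeD AU (leeD (Ud _ sd) _)) _.
  apply: le_trans (mu_bounded sr mAU) _.
  by apply: lee_wpmul2l AU; rewrite lee_fin ltW.
rewrite -EFinM -!EFinD lee_fin [leLHS](_ : _ = e)//; field.
by rewrite gt_eqF// addr_gt0.
Qed.

Definition translation_L1_continuous (g : measurableTypeR R -> R) :=
  measurable_fun setT g /\ forall e, 0 < e -> exists2 d, 0 < d &
    forall s, `|s| < d -> (\int[mu]_x `|translate s g x - g x|%:E <= e%:E)%E.

Lemma measurable_normB (f g : measurableTypeR R -> R) :
  measurable_fun setT f -> measurable_fun setT g ->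
  measurable_fun setT (fun x => `|f x - g x|%:E).
Proof.
move=> mf mg; apply/measurable_EFinP.
by apply: measurableT_comp => //; exact: measurable_funB.
Qed.

Lemma integral_normB_triangle (f g h : measurableTypeR R -> R) :
  measurable_fun setT f -> measurable_fun setT g -> measurable_fun setT h ->
  (\int[mu]_x `|f x - h x|%:E <=
   \int[mu]_x `|f x - g x|%:E + \int[mu]_x `|g x - h x|%:E)%E.
Proof.
move=> mf mg mh; rewrite -ge0_integralD//.
- apply: ge0_le_integral => //.
  + exact: measurable_normB.
  + by apply: emeasurable_funD; exact: measurable_normB.
  + by move=> x _; rewrite -EFinD lee_fin; exact: ler_distD.
- exact: measurable_normB.
- exact: measurable_normB.
Qed.

Lemma translation_L1_continuousZ_indic (y : R) A : measurable A ->
  (y != 0 -> (mu A < +oo)%E) ->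
  translation_L1_continuous (fun x => y * \1_A x).
Proof.
move=> mA Aoo; split.
  by apply: measurable_funM => //; exact: measurable_indic.
move=> e e0; have [y0|y0] := eqVneq y 0.
  exists 1 => // s _; rewrite integral0_eq ?lee_fin ?ltW// => x _.
  by rewrite /translate y0 !mul0r subrr normr0.
have ny0 : 0 < `|y| by rewrite normr_gt0.
have ey0 : 0 < e / `|y| by rewrite divr_gt0.
have [d d0 Ad] := translate_setY_small mA (Aoo y0) ey0.
exists d => // s sd.
have mtA : measurable (translate s A : set (measurableTypeR R)).
  exact: measurable_translate_set.
have mY : measurable (A `+` translate s A) by exact: measurable_setY.
have -> : (\int[mu]_x `|translate s (fun x => y * \1_A x) x - y * \1_A x|%:E =
    \int[mu]_x (`|y|%:E * (\1_(A `+` translate s A) x)%:E))%E.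
  apply: eq_integral => x _; rewrite /translate -mulrBr normrM -EFinM.
  congr (_ * _)%:E; rewrite setY_def !indicE.
  rewrite in_setU !in_setD.
  have -> : (x \in (translate s A : set (measurableTypeR R))) =
    ((x - s : measurableTypeR R) \in A) by [].
  by case: (x \in A); case: (_ \in A);
    rewrite /= ?subrr ?normr0 ?subr0 ?sub0r ?normrN ?normr1.
rewrite ge0_integralZl//; last first.
  by apply/measurable_EFinP; exact: measurable_indic.
rewrite integral_indic// setIT.
apply: (@le_trans _ _ (`|y|%:E * (e / `|y|)%:E)%E).
  by apply: lee_wpmul2l; rewrite ?lee_fin ?Ad.
by rewrite -EFinM lee_fin mulrCA divff ?mulr1// gt_eqF.
Qed.

Lemma translation_L1_continuousD f g : translation_L1_continuous f ->
  translation_L1_continuous g -> translation_L1_continuous (fun x => f x + g x).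
Proof.
move=> [mf fc] [mg gc]; split; first exact: measurable_funD.
move=> e e0; have e20 : 0 < e / 2 by rewrite divr_gt0.
have [d d0 fd] := fc _ e20; have [d' d'0 gd'] := gc _ e20.
exists (Num.min d d') => [|s]; first by rewrite lt_min d0.
rewrite lt_min => /andP[sd sd'].
rewrite (splitr e) EFinD; apply: le_trans (leeD (fd _ sd) (gd' _ sd')).
have mtf := measurable_translate s mf; have mtg := measurable_translate s mg.
rewrite -ge0_integralD//; [|exact: measurable_normB|exact: measurable_normB].
apply: ge0_le_integral => //.
- apply: (@measurable_normB (fun x => translate s f x + translate s g x)
    (fun x => f x + g x)); exact: measurable_funD.
- by apply: emeasurable_funD; exact: measurable_normB.
- move=> x _; rewrite -EFinD lee_fin /translate opprD addrACA.
  exact: ler_normD.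
Qed.

Lemma translation_L1_continuous_sum (I : Type) (l : seq I)
    (F : I -> measurableTypeR R -> R) :
  (forall i, translation_L1_continuous (F i)) ->
  translation_L1_continuous (fun x => \sum_(i <- l) F i x).
Proof.
move=> Fc; elim: l => [|i l IHl].
  have -> : (fun x : measurableTypeR R => \sum_(i <- [::]) F i x) =
      (fun x => 0 * \1_set0 x).
    by apply/funext => x; rewrite big_nil mul0r.
  by apply: translation_L1_continuousZ_indic; rewrite ?eqxx.
under eq_fun do rewrite big_cons.
exact: translation_L1_continuousD.
Qed.

(** The set of functions along which translation is L1-continuous is closed in L1,
as translations near 0 are uniformly bounded, and contains the integrable simple
functions. *)
Lemma integrable_translation_L1_continuous (g : measurableTypeR R -> R) :
  mu.-integrable setT (EFin \o g) -> translation_L1_continuous g.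
Proof.
move=> ig.
have mg : measurable_fun setT g by apply/measurable_EFinP; case/integrableP: ig.
split => // e e0.
have e10 : 0 < e / (2 + M) by rewrite divr_gt0// addr_gt0.
have [h_ [ih _ /cvge0_exists_le-/(_ _ e10)[n gh]]] :=
  @approximation_sfun_integrable _ _ _ mu _ measurableT _ ig.
pose h : {sfun measurableTypeR R >-> R} := h_ n.
have mh : measurable_fun setT h by exact: measurable_funP.
have [_ hc] : translation_L1_continuous h.
  have -> : (h : measurableTypeR R -> R) =
      (fun x => \sum_(y <- finmap.enum_fset (fset_set (range h)))
        (y * \1_(h @^-1` [set y]) x)).
    by apply/funext => x; rewrite fimfunE fsbig_finite.
  apply: translation_L1_continuous_sum => y.
  have mhy : measurable (h @^-1` [set y]).
    by rewrite -[X in measurable X]setTI; exact: mh.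
  apply: translation_L1_continuousZ_indic => // y0.
  have ny0 : 0 < `|y| by rewrite normr_gt0.
  have hoo : (\int[mu]_x `|h x|%:E < +oo)%E.
    by have /integrableP[_] := ih n.
  have : (`|y|%:E * mu (h @^-1` [set y]) < +oo)%E.
    apply: le_lt_trans hoo.
    rewrite -[X in (_ * mu X)%E]setIT -integral_indic// -ge0_integralZl//; last first.
      by apply/measurable_EFinP; exact: measurable_indic.
    apply: ge0_le_integral => //.
    - apply: emeasurable_funM => //; apply/measurable_EFinP.
      exact: measurable_indic.
    - by apply/measurable_EFinP; exact: measurableT_comp.
    - move=> x _; rewrite -EFinM lee_fin indicE.
      have [|_] := boolP (x \in _); last by rewrite mulr0.
      by rewrite inE/= => ->; rewrite mulr1.
  rewrite !ltey; apply: contra_neq => ->; rewrite gt0_muley// lte_fin.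
have [d d0 hd] := hc _ e10.
exists (Num.min d r) => [|s]; first by rewrite lt_min d0.
rewrite lt_min => /andP[sd sr].
have mtg := measurable_translate s mg; have mth := measurable_translate s mh.
have ghE : (\int[mu]_x `|g x - h x|%:E <= (e / (2 + M))%:E)%E.
  by apply: le_trans gh; apply: ge0_le_integral => //;
   exact: measurable_normB.
apply: le_trans (integral_normB_triangle mtg mth mg) _.
apply: le_trans (leeD (lexx _) (integral_normB_triangle mth mh mg)) _.
have tghE : (\int[mu]_x `|translate s g x - translate s h x|%:E <=
    M%:E * (e / (2 + M))%:E)%E.
  apply: (le_trans (@integral_translate_le s M (ltW M0) _
    (fun x => `|g x - h x|%:E) _ _)) => //.
  - by move=> A mA; exact: mu_bounded.
  - exact: measurable_normB.
  - by apply: lee_wpmul2l; rewrite // lee_fin ltW.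
apply: le_trans (leeD tghE (leeD (hd _ sd) _)) _.
  by under eq_integral do rewrite distrC; exact: ghE.
rewrite -EFinM -!EFinD lee_fin [leLHS](_ : _ = e)//; field.
by rewrite gt_eqF// addr_gt0.
Qed.

End translation_L1.
(** * From L1 to Lp *)

Section signed_power.
Context (R : realType) (p : R).
Hypothesis p1 : 1 <= p.
Implicit Types a b c : R.

(** For 0 < x <= a + c the ratio y = x / (a + c) satisfies y `^ p <= y; the two
ratios add up to 1. *)
Lemma powR_superadditive a c : 0 <= a -> 0 <= c ->
  a `^ p + c `^ p <= (a + c) `^ p.
Proof.
move=> a0 c0.
have p0 : p != 0 by rewrite gt_eqF// (lt_le_trans ltr01).
have [->|an0] := eqVneq a 0; first by rewrite powR0// !add0r.
have [->|cn0] := eqVneq c 0; first by rewrite powR0// !addr0.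
have {}a0 : 0 < a by rewrite lt0r an0.
have {}c0 : 0 < c by rewrite lt0r cn0.
have s0 : 0 < a + c by rewrite addr_gt0.
have le x : 0 < x <= a + c -> x `^ p <= x / (a + c) * (a + c) `^ p.
  move=> /andP[x0 xs]; rewrite -[in leLHS](divfK (lt0r_neq0 s0) x).
  apply: ge1r_powRZ => //; last exact: ltW.
  by rewrite divr_gt0//= ler_pdivrMr// mul1r.
apply: (le_trans (lerD (le a _) (le c _))).
- by rewrite a0 lerDl ltW.
- by rewrite c0 lerDr ltW.
- by rewrite -mulrDl -mulrDl divff ?mul1r// gt_eqF.
Qed.

Lemma powR_distance a b : 0 <= b -> b <= a -> (a - b) `^ p <= a `^ p - b `^ p.
Proof.
move=> b0 ba; rewrite lerBrDr.
by apply: le_trans (powR_superadditive _ _) _; rewrite ?subr_ge0// subrK.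
Qed.

(** The map a |-> sgn a |a|^p, in a form that is visibly measurable. *)
Definition signed_powR a := Num.max a 0 `^ p - Num.max (- a) 0 `^ p.

Let p0 : p != 0. Proof. by rewrite gt_eqF// (lt_le_trans ltr01). Qed.

Lemma signed_powR_ge0 a : 0 <= a -> signed_powR a = a `^ p.
Proof.
move=> a0; rewrite /signed_powR (max_idPl a0) (max_idPr _) ?oppr_le0//.
by rewrite powR0// subr0.
Qed.

Lemma signed_powRN a : signed_powR (- a) = - signed_powR a.
Proof. by rewrite /signed_powR opprK opprB. Qed.

Lemma norm_signed_powR a : `|signed_powR a| = `|a| `^ p.
Proof.
have [a0|a0] := leP 0 a.
  by rewrite signed_powR_ge0// (ger0_norm a0) ger0_norm// powR_ge0.
rewrite -normrN -signed_powRN signed_powR_ge0 ?oppr_ge0 ?ltW//.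
by rewrite (ltr0_norm a0) ger0_norm// powR_ge0.
Qed.

(** For a and b of the same sign this is superadditivity of the power; for opposite
signs |a - b| is the sum of |a| and |b|, at most twice their maximum. *)
Lemma powR_le_signed_powR a b :
  `|a - b| `^ p <= 2 `^ p * `|signed_powR a - signed_powR b|.
Proof.
wlog ba : a b / b <= a.
  move=> H; have [ba|/ltW ab] := leP b a; first exact: H.
  by rewrite distrC [X in _ * X]distrC; exact: H.
have two : 1 <= 2 `^ p.
  by rewrite -[leLHS](powRr0 2) ler_powR ?ler1n// (le_trans ler01).
have one x y : x <= y -> 0 <= y -> x <= 2 `^ p * y.
  by move=> xy y0; apply: le_trans xy _; rewrite ler_peMl.
rewrite [X in X `^ p]ger0_norm ?subr_ge0//.
have [b0|b0] := leP 0 b.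
  apply: one => //; rewrite !signed_powR_ge0 ?(le_trans b0)//.
  exact: le_trans (powR_distance b0 ba) (ler_norm _).
have [a0|a0] := leP a 0.
  apply: one => //; rewrite (_ : a - b = - b - - a); last by ring.
  rewrite (_ : signed_powR a - signed_powR b = (- b) `^ p - (- a) `^ p).
    by apply: le_trans (ler_norm _); apply: powR_distance; rewrite ?oppr_ge0 ?lerN2.
  rewrite -(signed_powR_ge0 (_ : 0 <= - b)) ?oppr_ge0 ?(ltW b0)//.
  rewrite -(signed_powR_ge0 (_ : 0 <= - a)) ?oppr_ge0// !signed_powRN; ring.
have Nb0 : 0 <= - b by rewrite oppr_ge0 ltW.
rewrite (_ : signed_powR a - signed_powR b = a `^ p + (- b) `^ p); last first.
  by rewrite -(signed_powR_ge0 Nb0) -(signed_powR_ge0 (ltW a0)) signed_powRN.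
set c := - b in Nb0 *; rewrite (ger0_norm (addr_ge0 _ _)) ?powR_ge0//.
apply: (@le_trans _ _ ((2 * Num.max a c) `^ p)).
  apply: ge0_ler_powR; first exact: le_trans p1.
  - by rewrite nnegrE addr_ge0// ltW.
  - by rewrite nnegrE mulr_ge0// le_max (ltW a0).
  - by rewrite mulr_natl mulr2n lerD// le_max lexx ?orbT.
rewrite powRM ?le_max ?(ltW a0)// ler_wpM2l ?powR_ge0//.
by case: (leP a c) => _; rewrite ?lerDr ?lerDl powR_ge0.
Qed.

Lemma measurable_signed_powR d (T : measurableType d) (f : T -> R) :
  measurable_fun setT f -> measurable_fun setT (signed_powR \o f).
Proof.
move=> mf; apply: measurable_funB.
  apply: (@measurableT_comp _ _ _ _ _ _ (@powR R ^~ p)) => //.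
  exact: measurable_maxr.
apply: (@measurableT_comp _ _ _ _ _ _ (@powR R ^~ p)) => //.
by apply: measurable_maxr => //; exact: measurableT_comp.
Qed.

End signed_power.

Section Lp.
Context d (T : measurableType d) (R : realType).
Context (mu : {measure set T -> \bar R}) (p : R).
Hypothesis p0 : 0 < p.
Implicit Types f : T -> R.

Lemma Lnorm_EFinE f : ('N[mu]_p%:E[EFin \o f] =
  (\int[mu]_x (`|f x| `^ p)%:E) `^ p^-1)%E.
Proof. by rewrite unlock. Qed.

Lemma LfunP f : f \in Lfun mu p%:E <->
  measurable_fun setT f /\ (\int[mu]_x (`|f x| `^ p)%:E < +oo)%E.
Proof.
have E : finite_norm mu p%:E f <-> (\int[mu]_x (`|f x| `^ p)%:E < +oo)%E.
  rewrite /finite_norm Lnorm_EFinE; split; last exact: poweR_lty.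
  by apply: lty_poweRy; rewrite invr_neq0// gt_eqF.
split=> [/andP[]|[mf foo]]; rewrite ?inE/=.
  by move=> mf foo; split => //; exact/E.
by apply/andP; rewrite !inE/=; split => //; exact/E.
Qed.

End Lp.

Lemma ge0_cvg_dnbhs0 (R : realType) (N : R -> \bar R) :
  (forall s, 0 <= N s)%E ->
  (forall e, 0 < e -> exists2 d, 0 < d & forall s, `|s| < d -> (N s <= e%:E)%E) ->
  N s @[s --> (0 : R)^'] --> 0%E.
Proof.
move=> N0 Ne.
have near_le e : 0 < e -> \forall s \near (0 : R)^', (N s <= e%:E)%E.
  move=> /Ne[d d0 Nd]; exists d => //= s.
  by rewrite /= sub0r normrN => sd _; exact: Nd.
apply/fine_cvgP; split.
  apply: filterS (near_le 1 ltr01) => s Ns.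
  by rewrite ge0_fin_numE// (le_lt_trans Ns)// ltry.
apply/cvgrPdist_le => e e0.
apply: filterS (near_le e e0) => s Ns.
rewrite distrC subr0 ger0_norm ?fine_ge0//= -lee_fin fineK//.
by rewrite ge0_fin_numE// (le_lt_trans Ns)// ltry.
Qed.
Theorem theorem1 (R : realType) (p : R) (p1 : 1 <= p)
  (mu : {measure set (measurableTypeR R) -> \bar R})
  (mu_radon : is_radon mu)
  (mu_i : forall f g : measurableTypeR R -> \bar R,
    measurable_fun setT f ->
    measurable_fun setT g ->
    f = g %[ae mu] ->
    forall t : R, translate t f = translate t g %[ae mu])
  (mu_ii : forall f : measurableTypeR R -> R,
    measurable_fun setT f ->
    (\int[mu]_x (`|f x| `^ p)%:E < +oo)%E ->
    forall t : R, (\int[mu]_x (`|translate t f x| `^ p)%:E < +oo)%E) :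
  is_C0_group mu p%:E (@translate R R).
Proof.
have p0 : 0 < p by exact: lt_le_trans p1.
have Vp0 : 0 <= p^-1 by rewrite invr_ge0 ltW.
have mpow (f : measurableTypeR R -> R) : measurable_fun setT f ->
    measurable_fun setT (fun x => (`|f x| `^ p)%:E).
  move=> mf; apply/measurable_EFinP.
  apply: (@measurableT_comp _ _ _ _ _ _ (@powR R ^~ p)) => //.
  exact: measurableT_comp.
have pow_ge0 (f : measurableTypeR R -> R) x : (0 <= (`|f x| `^ p)%:E)%E.
  by rewrite lee_fin powR_ge0.
have bounded := translate_measure_bounded p1 mu_i mu_ii.
split.
- move=> t f /(LfunP _ p0)[mf foo]; apply/(LfunP _ p0); split.
    exact: measurable_translate.
  exact: mu_ii.
- move=> t f g /(LfunP _ p0)[mf _] /(LfunP _ p0)[mg _] fg.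
  have tfg : (translate t (EFin \o f) : measurableTypeR R -> \bar R) =
      translate t (EFin \o g) %[ae mu].
    apply: mu_i; [exact/measurable_EFinP|exact/measurable_EFinP|].
    by apply: (filterS _ fg) => x /= /[apply] ->.
  by apply: (filterS _ tfg) => x /= /[apply] -[].
- by move=> t a f g _ _; exact: ae_eq_refl.
- move=> t; have [C C0 CA] := bounded t; exists (C `^ p^-1).
  move=> f /(LfunP _ p0)[mf _]; rewrite !Lnorm_EFinE -poweR_EFin -poweRM//; last 2 first.
    by rewrite lee_fin ltW.
    exact: integral_ge0.
  apply: gt0_ler_poweR => //.
  + by rewrite in_itv/= leey andbT; exact: integral_ge0.
  + rewrite in_itv/= leey andbT mule_ge0//; first by rewrite lee_fin ltW.
    exact: integral_ge0.
  + exact: (integral_translate_le (ltW C0) CA (mpow _ mf)).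
- move=> f _; apply: aeW => x _.
  by rewrite /translate subr0.
- move=> s t f _; apply: aeW => x _.
  by rewrite /translate opprD addrA.
- move=> f /(LfunP _ p0)[mf foo].
  have [M M0 [r r0 Mr]] := translate_measure_locally_bounded mu_radon bounded.
  have mg := measurable_signed_powR p mf.
  have ig : mu.-integrable setT (EFin \o (signed_powR p \o f)).
    apply/integrableP; split; first exact/measurable_EFinP.
    by under eq_integral do rewrite /= norm_signed_powR//.
  have [_ gc] := integrable_translation_L1_continuous mu_radon M0 r0 Mr ig.
  apply: ge0_cvg_dnbhs0 => [s|e e0]; first exact: Lnorm_ge0.
  have k0 : 0 < (2 : R) `^ p by rewrite powR_gt0.
  have e'0 : 0 < e `^ p / 2 `^ p by rewrite divr_gt0// powR_gt0.
  have [d d0 gd] := gc _ e'0; exists d => // s sd.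
  have mtf := measurable_translate s mf.
  have mtg := measurable_translate s mg.
  rewrite Lnorm_EFinE.
  have -> : e%:E = ((e `^ p)%:E `^ p^-1)%E.
    by rewrite poweR_EFin -powRrM divff ?gt_eqF// powRr1// ltW.
  apply: gt0_ler_poweR => //.
  + by rewrite in_itv/= leey andbT; apply: integral_ge0 => x _; rewrite lee_fin powR_ge0.
  + by rewrite in_itv/= leey andbT lee_fin powR_ge0.
  + apply: (@le_trans _ _ (\int[mu]_x ((2 `^ p)%:E *
        `|translate s (signed_powR p \o f) x - (signed_powR p \o f) x|%:E))%E).
      apply: ge0_le_integral => //.
      * by apply: (mpow (fun x => translate s f x - f x)); exact: measurable_funB.
      * by apply: emeasurable_funM => //; exact: measurable_normB.
      * by move=> x _; rewrite -EFinM lee_fin; exact: powR_le_signed_powR.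
    rewrite ge0_integralZl//; last exact: measurable_normB.
    apply: (@le_trans _ _ ((2 `^ p)%:E * (e `^ p / 2 `^ p)%:E)%E).
      by apply: lee_wpmul2l; [rewrite lee_fin ltW|exact: gd].
    by rewrite -EFinM mulrCA divff ?mulr1// gt_eqF.
Qed.
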